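(* Let $q>2$. Define \[ m_2=\begin{cases}(q-1)(q-2)/2-1 & q\neq 6,\\ (q-1)(q-2)/2-2 & q=6,\end{cases}\qquad m_3=\begin{cases}(q-1)^3/2-1 & q \text{ odd},\\ \bigl((q-1)^3-(3q^2-6q+4)/4\bigr)/2-1 & q\text{ even}, q\neq 6,\\ \bigl((q-1)^3-(3q^2-6q+4)/4\bigr)/2-2 & q=6.\end{cases}\] Then for every $s\ge 0$ there exist a good orientable sequence of order $2s+3$ over $\mathbb{Z}_q$ with period at least $q^{2s+1}m_2+\frac{q^{2s+1}-1}{q-1}$, and a good orientable sequence of order $2s+4$ over $\mathbb{Z}_q$ with period at least $q^{2s+1}m_3+\frac{q^{2s+1}-1}{q-1}$.
   Context: Sequences are periodic with entries in $\mathbb{Z}_q$. For $S=(s_i)$ write $\mathbf{s}_n(i)=(s_i,\ldots,s_{i+n-1})$; for an $n$-tuple $\mathbf{u}=(u_0,\ldots,u_{n-1})$ let $\mathbf{u}^R=(u_{n-1},\ldots,u_0)$. A periodic sequence of period $m$ is an $n$-window sequence if $\mathbf{s}_n(i)=\mathbf{s}_n(j)$ implies $i\equiv j\pmod m$; it is an orientable sequence of order $n$ if also $\mathbf{s}_n(i)\neq \mathbf{s}_n(j)^R$ for all $i,j$. A run of $0$ is a maximal block of consecutive terms all equal to $0$ (in the periodic sequence). An orientable sequence of order $n$ is called good if every run of $0$ in it has length at most $n-2$. *)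

(* Defs.v *)
From HB Require Import structures.
From mathcomp Require Import all_boot all_order all_algebra.

Set Implicit Arguments.
Unset Strict Implicit.
Unset Printing Implicit Defensive.

Import Order.TTheory GRing.Theory Num.Theory.

(* Periodic sequences are indexed by nat: a periodic sequence is determined   *)
(* by its terms of nonnegative index.  'Z_q is Z/qZ only when 1 < q.          *)

Definition window (T : Type) (n : nat) (s : nat -> T) (i : nat) : seq T :=
  mkseq (fun k => s (i + k)) n.

Definition has_period (T : Type) (m : nat) (s : nat -> T) : Prop :=
  0 < m /\ forall i, s (i + m) = s i.

Definition window_sequence (T : Type) (n m : nat) (s : nat -> T) : Prop :=
  has_period m s /\
  forall i j, window n s i = window n s j -> i = j %[mod m].

Definition orientable (T : Type) (n m : nat) (s : nat -> T) : Prop :=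
  window_sequence n m s /\
  forall i j, window n s i <> rev (window n s j).

(* The run is s_(i+1), ..., s_(i+l), so that it always has a left neighbour;  *)
(* by periodicity every run of a sequence that is not identically zero occurs *)
(* at such a position (the zero sequence is never orientable).                *)
Definition zero_run (q : nat) (s : nat -> 'Z_q) (i l : nat) : Prop :=
  [/\ 0 < l,
      forall k, k < l -> s (i + 1 + k) = 0%R,
      s i <> 0%R
    & s (i + 1 + l) <> 0%R].

Definition good_orientable (q n m : nat) (s : nat -> 'Z_q) : Prop :=
  orientable n m s /\ forall i l, zero_run s i l -> l + 2 <= n.

Local Open Scope ring_scope.

Definition m2 (q : nat) : rat :=
  let x : rat := q%:R in
  if q == 6 then (x - 1) * (x - 2) / 2 - 2
  else (x - 1) * (x - 2) / 2 - 1.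

Definition m3 (q : nat) : rat :=
  let x : rat := q%:R in
  if odd q then (x - 1) ^+ 3 / 2 - 1
  else if q == 6 then
    ((x - 1) ^+ 3 - (3 * x ^+ 2 - 6 * x + 4) / 4) / 2 - 2
  else ((x - 1) ^+ 3 - (3 * x ^+ 2 - 6 * x + 4) / 4) / 2 - 1.

(* Main.v *)
Require Import Defs.
From HB Require Import structures.
From mathcomp Require Import all_boot all_order all_algebra all_fingroup.
From mathcomp Require Import zify ring lra.

Set Implicit Arguments.
Unset Strict Implicit.
Unset Printing Implicit Defensive.

Import Order.TTheory GRing.Theory Num.Theory.
Local Open Scope ring_scope.

(** Call a sequence negative orientable if no window is the negated reversal of
    a window.  Taking partial sums modulo [q] (the inverse of the Lempel
    homomorphism) turns a negative orientable sequence of order [n] into an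
    orientable one of order [n + 1] and conversely, and multiplies the period by
    [q] when the sum over a period is a unit.  All translates of a window then
    occur, so a longest run of any constant [c <> 0] can be lengthened by one
    term to make the sum a unit again; periods thus evolve by [m -> q m + 1],
    and an odd number of steps leads from a negative orientable sequence of
    order 2 or 3 to the desired one.

    The starting sequences are Eulerian circuits.  For order 2 the edges are the
    pairs of nonzero residues with [a + b < q], for order 3 the triples with
    [2 (a + b + c) < 3 q]; negation reverses these inequalities.  For order 3 the
    rotations of [(0, 1, 1)] are added, so that a [0] occurs.  Deleting at most
    one loop (two if [q = 6]) makes the sum a unit. *)

(** * Eulerian circuits in finite directed graphs *)

(** The edge [u] starts at the vertex [hd u] and ends at [tl u]. Asking for a permutation as
    successor map encodes that each vertex has equal in-degree and out-degree. *)
Definition eulerian_perm (T : finType) (V : eqType) (hd tl : T -> V)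
    (E : {set T}) (p : {perm T}) : bool :=
  [forall u in E, (p u \in E) && (hd (p u) == tl u)].

Lemma eulerian_permP (T : finType) (V : eqType) (hd tl : T -> V)
    (E : {set T}) (p : {perm T}) :
  reflect (forall u, u \in E -> p u \in E /\ hd (p u) = tl u)
          (eulerian_perm hd tl E p).
Proof.
apply: (iffP forall_inP) => H u /H; first by case/andP=> ? /eqP.
by case=> -> ->; rewrite eqxx.
Qed.

Lemma perm_closed_set (T : finType) (E : {set T}) (p : {perm T}) :
  (forall u, u \in E -> p u \in E) -> forall u, (p u \in E) = (u \in E).
Proof.
move=> pE u; have /setP/(_ (p u)) : p @: E = E.
  apply/eqP; rewrite eqEcard card_imset ?leqnn; last exact: perm_inj.
  by rewrite andbT; apply/subsetP=> _ /imsetP[x xE ->]; apply: pE.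
by rewrite mem_imset //; apply: perm_inj.
Qed.

(* Among the successor permutations on the edge set, one with the least number
   of cycles is a single cycle on the edges: otherwise, by connectedness, two
   cycles pass through a common vertex, and a transposition merges them. *)
Lemma euler_circuit (T : finType) (V : eqType) (hd tl : T -> V)
    (E : {set T}) (p0 : {perm T}) :
  eulerian_perm hd tl E p0 ->
  (forall A : {set T},
     (forall x y, x \in E -> y \in E -> hd y = tl x -> (x \in A) = (y \in A)) ->
     forall x y, x \in E -> y \in E -> x \in A -> y \in A) ->
  exists2 p : {perm T}, eulerian_perm hd tl E p &
    forall u, u \in E -> porbit p u = E.
Proof.
move=> p0P conn.
have [p pP pmin] := arg_minnP (fun p : {perm T} => #|porbits p|) p0P.
exists p => // u uE; have /eulerian_permP H := pP.
have pE v : (p v \in E) = (v \in E).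
  by apply: perm_closed_set => {}v /H[].
have orbE v i : v \in E -> (p ^+ i)%g v \in E.
  by move=> vE; elim: i => [|i IH]; rewrite ?expg0 ?perm1 // expgSr permM pE.
have merge x y : x \in E -> y \in E -> tl x = tl y -> x \in porbit p y.
  move=> xE yE xy; apply/negPn/negP=> xNy.
  have := porbits_mul_tperm p x y; rewrite xNy /=.
  have xDy : x != y by apply: contraNneq xNy => ->; apply: porbit_id.
  rewrite xDy => /= Hc.
  have /pmin : eulerian_perm hd tl E (tperm x y * p)%g.
    apply/eulerian_permP => v vE; rewrite permM.
    by case: tpermP => [->|->|_ _]; [have [? ->] := H _ yE|
      have [? ->] := H _ xE|have [? ->] := H _ vE].
  by rewrite -(leq_add2r 1) -Hc leq_add2l.
apply/setP=> v; apply/idP/idP=> [/porbitP[i ->]|vE]; first exact: orbE.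
apply: (conn (porbit p u) _ u v) => //; last exact: porbit_id.
move=> x y xE yE yx.
(* The predecessor of [y] ends where [y] starts, which is where [x] ends, so [merge] puts [x] on the
   cycle of [y]. *)
have y'E : (p^-1)%g y \in E by rewrite -pE permKV.
have /eqP xy' : porbit p x == porbit p ((p^-1)%g y).
  rewrite eq_porbit_mem; apply: merge => //.
  by rewrite -yx; have [_ <-] := H _ y'E; rewrite permKV.
have /eqP yy' : porbit p y == porbit p ((p^-1)%g y).
  by rewrite eq_porbit_mem -[X in X \in _](permKV p) -[p _]/((p ^+ 1)%g _) mem_porbit.
by rewrite ![_ \in porbit p u]porbit_sym -!eq_porbit_mem xy' yy'.
Qed.

Lemma iter_porbit_mod (T : finType) (p : {perm T}) (u : T) i j :
  iter i p u = iter j p u -> i = j %[mod #|porbit p u|].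
Proof.
set m := #|_|; have m0 : (0 < m)%N by apply/card_gt0P; exists u; apply: porbit_id.
have red k : iter k p u = iter (k %% m) p u.
  rewrite {1}(divn_eq k m) addnC iterD; congr iter.
  by elim: (k %/ m)%N => //= d IH; rewrite mulSn iterD IH iter_porbit.
rewrite (red i) (red j) => H; apply/eqP.
rewrite -(nth_uniq u _ _ (uniq_traject_porbit p u)) ?size_traject ?ltn_mod //.
by rewrite !nth_traject ?ltn_mod // H.
Qed.

Lemma sum_iter_porbit (T : finType) (R : nmodType) (p : {perm T}) (u : T)
    (f : T -> R) :
  \sum_(i < #|porbit p u|) f (iter i p u) = \sum_(v in porbit p u) f v.
Proof.
rewrite -[RHS]big_enum /= -(big_mkord xpredT (fun i => f (iter i p u))).
have -> : \sum_(i <- enum (porbit p u)) f i =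
          \sum_(i <- traject p u #|porbit p u|) f i.
  apply: perm_big; apply: uniq_perm; rewrite ?enum_uniq ?uniq_traject_porbit //.
  by move=> x; rewrite mem_enum porbit_traject.
rewrite (big_nth u) size_traject big_nat_cond [RHS]big_nat_cond.
by apply: eq_bigr => i; rewrite andbT => /= ?; rewrite nth_traject.
Qed.

(** * Seeds and good orientable sequences *)

(* Order [N + 2] with windows compared to [e] times their reversals: [e = 1] is
   orientability and [e = -1] is its negative counterpart.  Tuples are compared
   termwise, so that the reversal sends position [k] to [N + 1 - k]. *)
Record seed (q N m : nat) (e : 'Z_q) (S : nat -> 'Z_q) : Prop := Seed {
  seed_gt0 : (0 < m)%N;
  seed_per : forall i, S (i + m)%N = S i;
  seed_inj : forall i j, (forall k, (k < N.+2)%N -> S (i + k)%N = S (j + k)%N) ->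
    i = j %[mod m];
  seed_ori : forall i j,
    ~ (forall k, (k < N.+2)%N -> S (i + k)%N = e * S (j + (N.+1 - k))%N);
  seed_nz : forall i, exists2 k, (k < N.+1)%N & S (i + k)%N <> 0;
  seed_z : exists i, forall k, (k < N)%N -> S (i + k)%N = 0;
  seed_unit : \sum_(i < m) S i \is a GRing.unit }.

(** In order [N + 2] goodness allows at most [N] zeros in a row, and [seed_nz] excludes [N + 1] of
    them. *)
Lemma seed_good_orientable (q N m : nat) (S : nat -> 'Z_q) :
  seed N m 1 S -> good_orientable N.+2 m S.
Proof.
case=> m0 per inj ori nz _ _; split; first split; first split=> //.
- move=> i j eqw; apply: inj => k kN.
  have := congr1 (fun t => nth 0 t k) eqw.
  by rewrite !nth_mkseq.
- move=> i j eqw; apply: (ori i j) => k kN.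
  have := congr1 (fun t => nth 0 t k) eqw.
  rewrite nth_rev ?size_mkseq // !nth_mkseq //; last by lia.
  by rewrite mul1r subSS.
move=> i l [l0 run _ _]; rewrite leqNgt; apply/negP=> lN.
have [k kN] := nz (i + 1)%N; apply; apply: run; lia.
Qed.

(** * Partial sums of periodic sequences *)

Lemma per_mod (T : Type) (m : nat) (S : nat -> T) :
  (forall i, S (i + m)%N = S i) -> forall i k, S (i + k)%N = S (i %% m + k)%N.
Proof.
move=> per i k; rewrite {1}(divn_eq i m) -addnA addnC.
by elim: (i %/ m)%N => [|d IH]; rewrite ?mul0n ?addn0 // mulSn addnCA addnC per.
Qed.

Lemma sum_shift (R : zmodType) (m p : nat) (S : nat -> R) :
  (forall i, S (i + m)%N = S i) ->
  \sum_(i < m) S (p + i)%N = \sum_(i < m) S i.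
Proof.
move=> per; elim: p => [|p <-] //.
case: m per => [|m] per; first by rewrite !big_ord0.
rewrite big_ord_recr big_ord_recl /= addSnnS per addn0 addrC; congr (_ + _).
by apply: eq_bigr => i _; rewrite /bump /= addSnnS.
Qed.

Definition partial_sums (R : nmodType) (S : nat -> R) (i : nat) : R :=
  \sum_(j < i) S j.

Lemma partial_sumsS (R : nmodType) (S : nat -> R) i :
  partial_sums S i.+1 = partial_sums S i + S i.
Proof. exact: big_ord_recr. Qed.

Lemma partial_sumsDper (R : pzRingType) (m : nat) (S : nat -> R) :
  (forall i, S (i + m)%N = S i) ->
  forall t i, partial_sums S (i + t * m)%N =
              partial_sums S i + t%:R * partial_sums S m.
Proof.
move=> per; have step i : partial_sums S (i + m) = partial_sums S i + partial_sums S m.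
  elim: i => [|i IH]; first by rewrite {2}/partial_sums big_ord0 add0r.
  by rewrite addSn !partial_sumsS IH per addrAC.
elim=> [|t IH] i; first by rewrite addn0 mul0r addr0.
by rewrite mulSn addnCA addnC step IH mulrSr mulrDl mul1r addrA.
Qed.

Lemma eqmod_addM m i j :
  i = j %[mod m] -> (i <= j)%N -> exists t, j = (i + t * m)%N.
Proof.
move=> /eqP ij lij; move: ij; rewrite eq_sym eqn_mod_dvd // => /dvdnP[t tE].
by exists t; rewrite -tE subnKC.
Qed.

(* The inverse of the Lempel homomorphism: windows of the partial sums determine
   windows of [S], and a unit weight makes all translates of each window occur. *)
Section Lift.
Variables (q N m : nat) (e : 'Z_q) (S : nat -> 'Z_q).
Hypotheses (q1 : (1 < q)%N) (seedS : seed N m e S).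
Let T : nat -> 'Z_q := partial_sums S.

Let TS i : S i = T i.+1 - T i.
Proof. by rewrite /T partial_sumsS addrAC subrr add0r. Qed.

Let TD t i : T (i + t * m)%N = T i + t%:R * T m.
Proof. exact: partial_sumsDper (seed_per seedS) t i. Qed.

Lemma lift_per i : T (i + q * m)%N = T i.
Proof. by rewrite TD pchar_Zp // mul0r addr0. Qed.

Lemma lift_inj i j :
  (forall k, (k < N.+3)%N -> T (i + k)%N = T (j + k)%N) ->
  i = j %[mod q * m].
Proof.
wlog lij : i j / (i <= j)%N.
  move=> W H; case: (leqP i j) => [|/ltnW] lij; first exact: W.
  by apply/esym/W => // k kN; rewrite H.
move=> H; have /(seed_inj seedS) ij : forall k, (k < N.+2)%N -> S (i + k)%N = S (j + k)%N.
  by move=> k kN; rewrite !TS -!addnS !H //; lia.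
(* Here [j = i + t * m], and equal first terms give [t * T m = 0]. Since [T m] is a unit, [q]
   divides [t]. *)
have [t jE] := eqmod_addM ij lij; have := H 0%N isT.
rewrite !addn0 jE TD -[LHS]addr0 => /addrI/esym.
have /mulIr mI := seed_unit seedS; rewrite -(mul0r (T m)) => /mI t0.
have /dvdnP[d ->] : (q %| t)%N.
  by have /eqP := congr1 (@nat_of_ord _) t0; rewrite val_Zp_nat.
by rewrite -mulnA addnC modnMDl.
Qed.

(** Differences read backwards change sign, so a relation with [- e] between sums becomes one with
    [e] between terms of [S]. *)
Lemma lift_ori i j :
  ~ (forall k, (k < N.+3)%N -> T (i + k)%N = - e * T (j + (N.+2 - k))%N).
Proof.
move=> H; apply: (seed_ori seedS (i := i) (j := j)) => k kN.
rewrite !TS -!addnS !H; [|lia..].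
by rewrite subSS (subSn (n := N.+1)) //; ring.
Qed.

Lemma lift_not_constant c i : exists2 k, (k < N.+2)%N & T (i + k)%N <> c.
Proof.
have [k kN Sk] := seed_nz seedS i.
case: (eqVneq (T (i + k)%N) c) => [Tk|/eqP]; last by exists k => //; lia.
by exists k.+1; rewrite ?addnS // -Tk => Tk1; apply: Sk; rewrite TS Tk1 subrr.
Qed.

(** A block of [N] zeros of [S] keeps [N + 1] partial sums equal; moving by [t] periods adds
    [t * T m], which takes every value. *)
Lemma lift_constant c : exists i, forall k, (k < N.+1)%N -> T (i + k)%N = c.
Proof.
have [i Sz] := seed_z seedS; set t := ((c - T i) / T m : 'Z_q).
exists (i + t * m)%N => k kN; rewrite addnAC TD natr_Zp divrK; last exact: seed_unit seedS.
suff -> : T (i + k)%N = T i by ring.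
elim: k kN => [|k IH] kN; first by rewrite addn0.
by rewrite addnS -[LHS](subrK (T (i + k)%N)) -TS Sz // add0r IH //; lia.
Qed.

End Lift.

(** * Lengthening a constant run by one term *)

(* One [c] is inserted in a run [x c^N y], for [N + 1] the length of the shortest
   constant block that does not occur.  The windows of the new sequence are those
   of the old one, except that [x c^N y] gives way to [x c^(N+1)] and [c^(N+1) y]. *)
Section Insert.
Variables (q N M : nat) (e c : 'Z_q) (T : nat -> 'Z_q).
Hypotheses (N0 : (0 < N)%N) (e2 : e * e = 1) (M0 : (0 < M)%N).
Hypothesis T_per : forall i, T (i + M)%N = T i.
Hypothesis T_inj : forall i j,
  (forall k, (k < N.+2)%N -> T (i + k)%N = T (j + k)%N) -> i = j %[mod M].
Hypothesis T_ori : forall i j,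
  ~ (forall k, (k < N.+2)%N -> T (i + k)%N = e * T (j + (N.+1 - k))%N).
Hypothesis T_nc : forall d i, exists2 k, (k < N.+1)%N & T (i + k)%N <> d.
Hypothesis T_c : forall k, (k < N)%N -> T k = c.

(** One period is [c] followed by [T 0], ..., [T M.-1]; as [T] starts with [N] terms [c], the run
    grows to [N + 1]. *)
Definition insert_term (i : nat) : 'Z_q :=
  if (i %% M.+1)%N is r.+1 then T r else c.
Let U := insert_term.

Lemma insert_per i : U (i + M.+1)%N = U i.
Proof. by rewrite /U /insert_term modnDr. Qed.

Let U_c k : (k <= N)%N -> U k = c.
Proof.
rewrite /U /insert_term => kN; case E: (k %% M.+1)%N => [|r] //; apply: T_c.
by have := leq_mod k M.+1; lia.
Qed.

(** The range may pass the end of the period by [N] because both sides are [c] there. *)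
Let U_T i : (i < M + N)%N -> U i.+1 = T i.
Proof.
move=> iM; case: (ltnP i M) => iM'.
  by rewrite /U /insert_term modn_small.
rewrite (_ : i.+1 = (i - M) + M.+1)%N; last lia.
rewrite insert_per U_c; last lia.
by rewrite -(subnK iM') T_per T_c //; lia.
Qed.

Let T_N : T N <> c.
Proof.
have [k kN] := T_nc c 0; rewrite add0n; case: (ltnP k N) => [/T_c //|?].
by rewrite (_ : k = N) //; lia.
Qed.

Let T_M1 : T M.-1 <> c.
Proof.
have [[|k] kN] := T_nc c M.-1; first by rewrite addn0.
by case; rewrite (_ : M.-1 + k.+1 = k + M)%N ?T_per ?(T_c (k := k)) //; lia.
Qed.

(** With x = [T M.-1] and y = [T N], the first two cases are c^(N+1) y and x c^(N+1). The bound
    [r.+1 < M] leaves out the broken window x c^N y, at index [M.-1] of [T]. *)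
Variant insert_window_spec i : Prop :=
| InsertRun of (i %% M.+1 = 0)%N & (forall k, (k <= N)%N -> U (i + k)%N = c)
    & U (i + N.+1)%N = T N
| InsertBeforeRun of (i %% M.+1 = M)%N & U i = T M.-1
    & (forall k, (0 < k)%N -> (k < N.+2)%N -> U (i + k)%N = c)
| InsertOld r of (i %% M.+1 = r.+1)%N & (r.+1 < M)%N
    & (forall k, (k < N.+2)%N -> U (i + k)%N = T (r + k)%N).

Lemma insert_windowP i : insert_window_spec i.
Proof.
have red k : U (i + k)%N = U (i %% M.+1 + k)%N by apply: per_mod; apply: insert_per.
have := ltn_pmod i (ltn0Sn M); case E: (i %% M.+1)%N => [|r] rM.
  apply: InsertRun => // [k kN|]; rewrite red E add0n; first exact: U_c.
  by rewrite U_T //; lia.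
case: (ltnP r.+1 M) => rM'.
  by apply: (InsertOld E) => // k kN; rewrite red E addSn U_T //; lia.
apply: InsertBeforeRun => [||k k0 kN]; first by lia.
  by rewrite -[i]addn0 red E addn0 U_T //; [congr T|]; lia.
rewrite red E (_ : r.+1 + k = k.-1 + M.+1)%N; last lia.
by rewrite insert_per U_c //; lia.
Qed.

(** Both new windows contain c^(N+1), which no old window does, and their first terms c and x
    differ. *)
Lemma insert_inj i j :
  (forall k, (k < N.+2)%N -> U (i + k)%N = U (j + k)%N) -> i = j %[mod M.+1].
Proof.
have no_run r d : ~ (forall k, (k < N.+1)%N -> T (r + k)%N = d).
  by move=> H; have [k kN] := T_nc d r; apply; apply: H.
move=> H; have H0 := H 0%N isT; rewrite !addn0 in H0.
case: (insert_windowP i) => [Ei Hi Hi'|Ei Hi Hi'|r Ei rM Hi];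
case: (insert_windowP j) => [Ej Hj Hj'|Ej Hj Hj'|r' Ej rM' Hj]; rewrite ?Ei ?Ej //.
- by case: T_M1; rewrite -Hj -H0 -[i]addn0 Hi.
- by case: (no_run r' c) => k kN; rewrite -Hj -?H ?Hi //; lia.
- by case: T_M1; rewrite -Hi H0 -[j]addn0 Hj.
- by case: (no_run r'.+1 c) => k kN; rewrite addSnnS -Hj -?H ?Hi' //; lia.
- by case: (no_run r c) => k kN; rewrite -Hi ?H ?Hj //; lia.
- by case: (no_run r.+1 c) => k kN; rewrite addSnnS -Hi ?H ?Hj' //; lia.
have /T_inj : forall k, (k < N.+2)%N -> T (r + k)%N = T (r' + k)%N.
  by move=> k kN; rewrite -Hi // -Hj // H.
by rewrite !modn_small; [move->|lia..].
Qed.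

Lemma insert_ori i j :
  ~ (forall k, (k < N.+2)%N -> U (i + k)%N = e * U (j + (N.+1 - k))%N).
Proof.
have no_run r d : ~ (forall k, (k < N.+1)%N -> T (r + k)%N = d).
  by move=> H; have [k kN] := T_nc d r; apply; apply: H.
have swap a b : a = e * b -> b = e * a by move=> ->; rewrite mulrA e2 mul1r.
(* If the two new windows were reversals of each other up to [e], the broken window x c^N y would
   already be [e] times its own reversal. *)
have pal : ~ (c = e * c /\ T N = e * T M.-1).
  case=> ec yx; apply: (T_ori (i := M.-1) (j := M.-1)) => k kN.
  have TM k' : (0 < k')%N -> (k' < N.+2)%N -> T (M.-1 + k')%N = T k'.-1.
    by move=> k0 _; rewrite (_ : M.-1 + k' = k'.-1 + M)%N ?T_per //; lia.
  case: (posnP k) => [->|k0].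
    by rewrite addn0 subn0 TM //; apply: swap.
  rewrite TM //; case: (ltngtP k N.+1) => kN1; [|lia|].
    by rewrite TM ?T_c ?T_c //; lia.
  by rewrite kN1 subnn addn0.
move=> H; have H' k : (k < N.+2)%N -> U (j + k)%N = e * U (i + (N.+1 - k))%N.
  by move=> kN; apply: swap; rewrite H; [congr (_ * U _)|]; lia.
have H0 := H 0%N isT; have HN := H N.+1 (ltnSn _); have H1 := H 1%N isT.
rewrite ?addn0 ?subn0 ?subnn ?addn0 in H0 HN.
case: (insert_windowP i) => [Ei Hi Hi'|Ei Hi Hi'|r Ei rM Hi];
case: (insert_windowP j) => [Ej Hj Hj'|Ej Hj Hj'|r' Ej rM' Hj].
- rewrite Hi ?Hj in H1; [|lia..].
  by case: T_N; rewrite -Hi' HN -[j]addn0 Hj // -H1.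
- apply: pal; rewrite -Hi' HN Hj; split=> //.
  by move: H0; rewrite -[i]addn0 Hi // Hj'.
- apply: (no_run r'.+1 (e * c)) => k kN.
  by rewrite addSnnS -Hj ?H' ?Hi //; lia.
- apply: pal; split; last by apply: swap; rewrite -Hi H0 Hj'.
  by move: HN; rewrite Hi' // -[j]addn0 Hj.
- rewrite Hi' ?Hj' in H1; [|lia..].
  by case: T_M1; rewrite -Hi H0 Hj' // -H1.
- apply: (no_run r' (e * c)) => k kN.
  by rewrite -Hj ?H' ?Hi' //; lia.
- apply: (no_run r.+1 (e * c)) => k kN.
  by rewrite addSnnS -Hi ?H ?Hj //; lia.
- apply: (no_run r (e * c)) => k kN.
  by rewrite -Hi ?H ?Hj' //; lia.
apply: (T_ori (i := r) (j := r')) => k kN.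
by rewrite -Hi // -Hj ?H //; lia.
Qed.

Lemma insert_nz : c <> 0 -> forall i, exists2 k, (k < N.+1)%N & U (i + k)%N <> 0.
Proof.
move=> c0 i; case: (insert_windowP i) => [_ Hi _|_ _ Hi|r _ _ Hi].
- by exists 0%N; rewrite ?Hi.
- by exists 1%N; rewrite ?Hi //; lia.
- by have [k kN Tk] := T_nc 0 r; exists k => //; rewrite Hi //; lia.
Qed.

Lemma insert_z i : (forall k, (k < N)%N -> T (i + k)%N = 0) ->
  exists j, forall k, (k < N)%N -> U (j + k)%N = 0.
Proof.
move=> H; exists (i %% M).+1 => k kN.
have iM := ltn_pmod i M0.
rewrite addSn U_T; last by lia.
by rewrite -(per_mod T_per) H.
Qed.

Lemma insert_weight : \sum_(i < M.+1) U i = c + \sum_(i < M) T i.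
Proof.
rewrite big_ord_recl /= [U 0%N]U_c //; congr (_ + _).
apply: eq_bigr => i _; rewrite /bump /= U_T //.
by have := ltn_ord i; lia.
Qed.

End Insert.

(** * Raising the order of a seed *)

Lemma seed_step (q N m : nat) (e : 'Z_q) (S : nat -> 'Z_q) :
  (2 < q)%N -> e * e = 1 -> seed N m e S ->
  exists S', seed N.+1 (q * m).+1 (- e) S'.
Proof.
move=> q2 e2 sS; have q1 : (1 < q)%N by lia.
have M0 : (0 < q * m)%N by rewrite muln_gt0 (seed_gt0 sS); lia.
have [w wE] : exists w, w = \sum_(i < q * m) partial_sums S i by eexists.
(* Adding [1 - w] makes the weight 1. This is zero if [w = 1]; then -2, nonzero as [q > 2], makes
   the weight -1. *)
have [c c0 cU] : exists2 c : 'Z_q, c <> 0 & c + w \is a GRing.unit.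
  case: (eqVneq w 1) => [->|w1].
    exists (- 1 - 1); last by rewrite subrK unitrN1.
    move/eqP; rewrite -opprD oppr_eq0 -(natrD _ 1 1) => /eqP/(congr1 (@nat_of_ord _)).
    by rewrite val_Zp_nat // modn_small.
  exists (1 - w); last by rewrite subrK unitr1.
  by move/eqP; rewrite subr_eq0 eq_sym => /eqP w1'; move: w1; rewrite w1' eqxx.
have [p pc] := lift_constant q1 sS c.
pose T i := partial_sums S (p + i)%N.
have T_per i : T (i + q * m)%N = T i by rewrite /T addnA (lift_per q1 sS).
have e2' : - e * - e = 1 by rewrite mulrNN.
have T_inj i j : (forall k, (k < N.+3)%N -> T (i + k)%N = T (j + k)%N) ->
    i = j %[mod q * m].
  move=> H; apply/eqP; rewrite -(eqn_modDl p); apply/eqP.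
  by apply: (lift_inj q1 sS) => k kN; rewrite -!addnA; apply: H.
have T_ori i j : ~ (forall k, (k < N.+3)%N ->
    T (i + k)%N = - e * T (j + (N.+2 - k))%N).
  move=> H; apply: (@lift_ori _ _ _ _ _ q1 sS (p + i) (p + j)) => k kN.
  by rewrite -!addnA; apply: H.
have T_nc d i : exists2 k, (k < N.+2)%N & T (i + k)%N <> d.
  have [k kN H] := lift_not_constant q1 sS d (p + i).
  by exists k => //; rewrite /T addnA.
exists (insert_term (q * m) c T); split=> //.
- exact: insert_per.
- exact: insert_inj.
- exact: insert_ori.
- exact: insert_nz.
- have [i iz] := lift_constant q1 sS 0.
  (* Adding [p] periods keeps the natural subtraction of the shift [p] from being truncated. *)
  pose j := (i + p * (q * m) - p)%N.
  apply: (insert_z (ltn0Sn N) M0 T_per pc (i := j)) => k kN.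
  rewrite /T /j (_ : (p + _)%N = (i + k) + p * (q * m))%N; last first.
    by have : (p <= p * (q * m))%N; [apply: leq_pmulr|lia].
  rewrite -(iz k kN); elim: (X in (_ + X * _)%N) => [|d IH]; first by rewrite addn0.
  by rewrite mulSn addnCA addnC (lift_per q1 sS).
by rewrite (insert_weight (ltn0Sn N)) // sum_shift -?wE //; apply: lift_per q1 sS.
Qed.

Lemma seed_iter (q N m k : nat) (e : 'Z_q) (S : nat -> 'Z_q) :
  (2 < q)%N -> e * e = 1 -> seed N m e S ->
  exists S', seed (k + N) (iter k (fun x => (q * x).+1) m) ((-1) ^+ k * e) S'.
Proof.
move=> q2 e2 sS; elim: k => [|k [S' sS']]; first by exists S; rewrite mul1r.
have [] := seed_step q2 _ sS'.
  by rewrite mulrACA e2 mulr1 -exprD addnn -mul2n exprM sqrrN !expr1n.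
by move=> S''; rewrite -mulNr -mulN1r -exprS; exists S''.
Qed.

(** * Seeds from Eulerian circuits *)

(** Edges are words [w u] of length [N + 2], and consecutive edges overlap in [N + 1] letters. The
    first letters along an Eulerian circuit thus form a sequence whose windows are the words of [E],
    once each per period. *)
Lemma circuit_seed (q N : nat) (e : 'Z_q) (T : finType) (V : eqType)
    (hd tl : T -> V) (w : T -> nat -> 'Z_q) (E : {set T}) (p0 : {perm T}) :
  (forall u v, hd v = tl u -> forall k, (k < N.+1)%N -> w v k = w u k.+1) ->
  {in E &, forall u v, (forall k, (k < N.+2)%N -> w u k = w v k) -> u = v} ->
  {in E &, forall u v, ~ (forall k, (k < N.+2)%N -> w u k = e * w v (N.+1 - k)%N)} ->
  {in E, forall u, exists2 k, (k < N.+1)%N & w u k <> 0} ->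
  (exists2 u, u \in E & forall k, (k < N)%N -> w u k = 0) ->
  \sum_(u in E) w u 0%N \is a GRing.unit ->
  eulerian_perm hd tl E p0 ->
  (forall A : {set T},
     (forall x y, x \in E -> y \in E -> hd y = tl x -> (x \in A) = (y \in A)) ->
     forall x y, x \in E -> y \in E -> x \in A -> y \in A) ->
  exists S, seed N #|E| e S.
Proof.
move=> shift winj ori nz [u uE uz] unitE p0P conn.
have [p /eulerian_permP pP orb] := euler_circuit p0P conn.
have itE i : iter i p u \in E by elim: i => //= i /pP[].
have wE k i : (k < N.+2)%N -> w (iter (i + k) p u) 0%N = w (iter i p u) k.
  elim: k i => [|k IH] i kN; first by rewrite addn0.
  rewrite -addSnnS IH; last by lia.
  by apply: shift; [case: (pP _ (itE i))|lia].
exists (fun i => w (iter i p u) 0%N); split.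
- by apply/card_gt0P; exists u.
- by move=> i; rewrite -(orb u uE) iterD iter_porbit.
- move=> i j H; rewrite -(orb u uE); apply: iter_porbit_mod.
  by apply: winj => // k kN; rewrite -(wE k i) // -(wE k j) // H.
- move=> i j H; apply: (ori _ _ (itE i) (itE j)) => k kN.
  by rewrite -(wE k i) // -(wE _ j) ?H //; lia.
- move=> i; have [k kN H] := nz _ (itE i).
  by exists k => //; rewrite wE //; lia.
- by exists 0%N => k kN; rewrite wE ?uz //; lia.
by rewrite -(orb u uE) (sum_iter_porbit p u (fun v => w v 0%N)) orb.
Qed.

(** * Reaching a unit weight by deleting loops *)

Lemma Zp_ltn (q : nat) (x : 'Z_q) : (1 < q)%N -> (x < q)%N.
Proof. by move=> q1; rewrite -[X in (_ < X)%N](Zp_cast q1). Qed.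

Lemma Zp_valN (q : nat) (x : 'Z_q) : (1 < q)%N -> (0 < x)%N -> - x = (q - x)%N :> nat.
Proof.
case: q x => [|[|q]] // x _ x0 /=.
by rewrite modn_small // ltn_subrL x0.
Qed.

Lemma Zp_val1 (q : nat) : (1 : 'Z_q) = 1%N :> nat.
Proof. by rewrite /= modn_small. Qed.

(** Take [v] to be -1 if [w = 0], 1 if [w] is small, and otherwise a unit near q/2: (q+1)/2 for odd
    q; for q = 2r, r+1 if r is even and r+2 if r is odd. For r odd and w = r+1, r-2 serves, except
    that 3 is too large a difference when q = 6. *)
Lemma coprime_near (q w : nat) : (2 < q)%N -> (w < q)%N ->
  (q = 6 /\ w = 4) \/
  exists a v, [/\ (2 * a < q)%N, coprime q v & (v + a = w \/ v + a = w + q)%N].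
Proof.
move=> q2 wq; case: (posnP w) => [->|w0].
  right; exists 1%N, q.-1; split; [lia| |lia].
  by rewrite -{1}(@prednK q) ?coprimeSn //; lia.
case: (ltnP (2 * w.-1) q) => w1.
  by right; exists w.-1, 1%N; split; [|rewrite coprimen1|lia].
have [qo|qe] := boolP (odd q).
  right; exists (w - q.+1./2)%N, q.+1./2; split; [lia| |lia].
  suff: coprime q (q.+1./2 * 2) by rewrite coprimeMr => /andP[].
  by rewrite (_ : (_ * 2)%N = q.+1) ?coprimenS //; lia.
have [r qr] : exists r, q = (r * 2)%N by exists q./2; lia.
have [ro|re] := boolP (odd r); last first.
  right; exists (w - r.+1)%N, r.+1; split; [lia| |lia].
  by rewrite qr coprimeMl coprimenS coprime2n /= re.
have cop2 : coprime r 2 by rewrite coprimen2.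
case: (ltnP w r.+2) => w2; last first.
  right; exists (w - r.+2)%N, r.+2; split; [lia| |lia].
  rewrite qr coprimeMl coprime2n /= negbK ro andbT.
  by rewrite /coprime -addn2 gcdnDl.
have [r3|r5] : r = 3 \/ (4 < r)%N by lia.
  by left; lia.
right; exists 3, (r - 2)%N; split; [lia| |lia].
rewrite qr coprimeMl coprime2n coprime_sym; apply/andP; split; last by lia.
rewrite /coprime -{2}(@subnKC 2 r) ?gcdnDr; last by lia.
by rewrite -/(coprime _ _) coprimen2; lia.
Qed.

(* Deleting the loops at the elements of [L] changes the weight of the edge set
   from [W] to a unit. *)
Lemma loops_to_unit (q : nat) (W : 'Z_q) : (2 < q)%N ->
  exists L : {set 'Z_q},
    [/\ forall a, a \in L -> (0 < a)%N && (2 * a < q)%N,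
        (#|L| <= (q == 6).+1)%N & W - \sum_(a in L) a \is a GRing.unit].
Proof.
move=> q2; have q1 : (1 < q)%N by lia.
have [[q6 w4]|[a [v [aq cop va]]]] := coprime_near q2 (Zp_ltn W q1).
  (* Deleting both loops leaves 4 - 3 = 1. *)
  subst q; exists [set 1; 2]; split.
  - by move=> a; rewrite !inE => /orP[] /eqP->.
  - by rewrite cards2.
  by rewrite big_setU1 ?inE //= big_set1 (_ : W = 4) ?unitr1 //; apply: val_inj.
have vW : v%:R = W - a%:R :> 'Z_q.
  apply/eqP; rewrite eq_sym subr_eq -natrD -[W]natr_Zp; case: va => -> //.
  by rewrite natrD pchar_Zp // addr0.
have Uv : W - a%:R \is a GRing.unit by rewrite -vW unitZpE.
case: (posnP a) => [a0|a0].
  exists set0; split; first by move=> ?; rewrite inE.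
    by rewrite cards0.
  by rewrite big_set0; rewrite a0 in Uv.
exists [set a%:R]; split.
- move=> b /set1P->; rewrite val_Zp_nat // modn_small; lia.
- by rewrite cards1.
- by rewrite big_set1.
Qed.

Section RemoveLoops.
Variables (q : nat) (T : finType) (F : {set T}) (L : {set 'Z_q}).
Variables (g : 'Z_q -> T) (f : T -> 'Z_q).
Hypotheses (gK : cancel g f) (gF : forall a, a \in L -> g a \in F).

Let sub : F :&: g @: L = g @: L.
Proof. by apply/setIidPr/subsetP=> _ /imsetP[a aL ->]; apply: gF. Qed.

Lemma card_remove_loops : #|F :\: g @: L| = (#|F| - #|L|)%N.
Proof. by rewrite cardsD sub card_imset //; apply: can_inj gK. Qed.

Lemma sum_remove_loops :
  \sum_(u in F :\: g @: L) f u = \sum_(u in F) f u - \sum_(a in L) a.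
Proof.
rewrite [in RHS](big_setID (g @: L)) sub /= big_imset /=; last first.
  by move=> a b _ _; apply: (can_inj gK).
under [X in X + _ - _]eq_bigr => a _ do rewrite gK.
by rewrite addrAC subrr add0r.
Qed.

End RemoveLoops.

(** Meant for [P] all tuples of nonzero residues, [F] the light ones and [M] those on the threshold,
    which negation preserves. *)
Lemma card_cover_neg (T : finType) (neg : T -> T) (P F M : {set T}) :
  P \subset F :|: neg @: F :|: M -> (#|P| <= 2 * #|F| + #|M|)%N.
Proof.
move=> /subset_leq_card/leq_trans; apply.
rewrite (leq_trans (leq_card_setU _ _)) // leq_add2r.
rewrite (leq_trans (leq_card_setU _ _)) // mul2n -addnn leq_add2l.
exact: leq_imset_card.
Qed.

(** * Seeds of order 2 *)

Section Base2.
Variable q : nat.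
Local Notation Z := 'Z_q.

Definition light2 : {set Z * Z} :=
  [set u : Z * Z | [&& (0 < u.1)%N, (0 < u.2)%N & (u.1 + u.2 < q)%N]].

Lemma in_light2 a b :
  ((a, b) \in light2) = [&& (0 < a)%N, (0 < b)%N & (a + b < q)%N].
Proof. by rewrite inE. Qed.

(** Pairs with sum above [q] are negations of light ones; the pairs with sum [q] are the [q - 1]
    pairs (a, -a). *)
Lemma card_light2 : (2 < q)%N -> ((q - 1) * (q - 2) <= 2 * #|light2|)%N.
Proof.
move=> q2; have q1 : (1 < q)%N by lia.
pose P : {set Z} := [set~ 0].
have cP : #|P| = (q - 1)%N by rewrite cardsC1 card_ord Zp_cast //; lia.
have sub : setX P P \subset
    light2 :|: (fun u : Z * Z => (- u.1, - u.2)) @: light2 :|: (fun a => (a, - a)) @: P.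
  apply/subsetP=> -[a b]; rewrite !inE /= => /andP[a0 b0].
  have a0' : (0 < a)%N by rewrite lt0n.
  have b0' : (0 < b)%N by rewrite lt0n.
  have aq := Zp_ltn a q1; have bq := Zp_ltn b q1.
  rewrite a0' b0' /=; case: (ltngtP (a + b) q) => //= ab.
    apply/orP; left; apply/imsetP; exists (- a, - b); last by rewrite !opprK.
    by rewrite in_light2 !Zp_valN //; lia.
  apply/orP; right; apply/imsetP; exists a; rewrite ?inE //; congr pair.
  by apply: val_inj; rewrite [RHS]Zp_valN //=; lia.
have := leq_imset_card (fun a : Z => (a, - a)) P.
have := card_cover_neg sub; rewrite cardsX cP.
move: #|light2| #|_ @: _| => c d; nia.
Qed.

Definition pair_term (u : Z * Z) (k : nat) : Z := if k is 0 then u.1 else u.2.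

Lemma base2 : (3 < q)%N ->
  exists S m, seed 0 m (-1 : Z) S /\
    ((q - 1) * (q - 2) <= 2 * (m + (q == 6).+1))%N.
Proof.
move=> q3; have q1 : (1 < q)%N by lia.
have [L [Lq Lc LU]] := loops_to_unit (\sum_(u in light2) u.1) (ltnW q3).
pose g (a : Z) := (a, a); have gK : cancel g fst by [].
have gF a : a \in L -> g a \in light2.
  by move=> /Lq/andP[a0 aq]; rewrite inE /= a0; lia.
pose E := light2 :\: g @: L.
have EP u : u \in E -> [&& (0 < u.1)%N, (0 < u.2)%N & (u.1 + u.2 < q)%N].
  by rewrite !inE => /andP[].
have EI (a b : Z) : a != b -> (0 < a)%N -> (0 < b)%N -> (a + b < q)%N -> (a, b) \in E.
  move=> ab a0 b0 abq; rewrite !inE /= a0 b0 abq !andbT.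
  by apply/imsetP=> -[c _ [ac bc]]; rewrite ac bc eqxx in ab.
have val1 := Zp_val1 q.
have val2 : (2%:R : Z) = 2%N :> nat by rewrite val_Zp_nat // modn_small //; lia.
have tE : (1, 2%:R) \in E.
  apply: EI; rewrite ?val2 ?val1 //.
  by apply/eqP=> /(congr1 (@nat_of_ord _)); rewrite val2 val1.
have swK : involutive (fun u : Z * Z => (u.2, u.1)) by case.
(* The light pairs are symmetric, so (b, a) may succeed (a, b). *)
have [] := @circuit_seed q 0 (-1) (Z * Z)%type Z fst snd pair_term E
  (perm (inv_inj swK)).
- by move=> u v H [|k] //.
- move=> [a b] [c d] _ _ H; congr pair; [exact: (H 0%N)|exact: (H 1%N)].
- move=> [a b] [c d] /EP/= /and3P[a0 b0 ab] /EP/= /and3P[c0 d0 cd] H.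
  have := H 0%N isT; have := H 1%N isT.
  rewrite /= !mulN1r => /(congr1 (@nat_of_ord _)) bE /(congr1 (@nat_of_ord _)) aE.
  by rewrite !Zp_valN // in aE bE; lia.
- move=> u /EP/and3P[u0 _ _]; exists 0%N => //= u00.
  by rewrite u00 in u0.
- by exists (1, 2%:R).
- by rewrite /= sum_remove_loops.
- apply/eulerian_permP => -[a b] uE; rewrite permE; split=> //=.
  move: uE; rewrite !inE /= addnC => /andP[ng /and3P[-> -> ->]].
  rewrite !andbT; apply: contra ng => /imsetP[c cL [-> ->]].
  exact: imset_f.
- move=> A HA.
  (* Every edge (a, b) leads to (1, 2), through (b, 1) if b is not 1; these connecting edges are not
     loops, so none was deleted. *)
  suff HT u : u \in E -> (u \in A) = ((1, 2%:R) \in A).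
    by move=> x y xE yE; rewrite !HT.
  case: u => a b uE; have [b1|b1] := eqVneq b 1.
    by apply: HA; rewrite //= b1.
  have /= /and3P[a0 b0 ab] := EP _ uE.
  have bE : (b, 1) \in E by apply: EI; rewrite ?val1 //; lia.
  by rewrite (HA _ _ uE bE) // (HA _ _ bE tE).
move=> S sS; exists S, #|E|; split=> //.
have := card_light2 (ltnW q3); rewrite (card_remove_loops gK gF).
by move: #|light2| #|L| Lc => c d; lia.
Qed.

End Base2.

(** For [q = 3] the only light pair is the loop (1, 1), which is kept. *)
Lemma base2_three : exists S : nat -> 'Z_3, seed 0 1 (-1) S.
Proof.
exists (fun=> 1); split=> //.
- by move=> i j _; rewrite !modn1.
- by move=> i j /(_ 0%N isT).
- by move=> i; exists 0%N.
- by exists 0%N.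
- by rewrite big_ord_recl big_ord0 addr0 unitr1.
Qed.

(** * Seeds of order 3 *)

Lemma card_ord_interval (n lo hi : nat) :
  (#|[set b : 'I_n | (lo <= b < hi)%N]| <= hi - lo)%N.
Proof.
rewrite cardE -(size_map (@nat_of_ord n)) -[X in (_ <= X)%N](size_iota lo).
apply: uniq_leq_size; first by rewrite map_inj_uniq ?enum_uniq //; apply: val_inj.
move=> _ /mapP[b + ->]; rewrite mem_enum inE mem_iota; lia.
Qed.

Section Base3.
Variable q : nat.
Hypothesis q2 : (2 < q)%N.
Local Notation Z := 'Z_q.
Local Notation Z3 := (Z * Z * Z)%type.

Let q1 : (1 < q)%N := ltnW q2.

Definition light3 : {set Z3} :=
  [set u : Z3 | [&& (0 < u.1.1)%N, (0 < u.1.2)%N, (0 < u.2)%N &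
                    (2 * (u.1.1 + u.1.2 + u.2) < 3 * q)%N]].

Definition balanced3 : {set Z3} :=
  [set u : Z3 | [&& (0 < u.1.1)%N, (0 < u.1.2)%N, (0 < u.2)%N &
                    (2 * (u.1.1 + u.1.2 + u.2) == 3 * q)%N]].

Lemma in_light3 a b c : ((a, b, c) \in light3) =
  [&& (0 < a)%N, (0 < b)%N, (0 < c)%N & (2 * (a + b + c) < 3 * q)%N].
Proof. by rewrite inE. Qed.

Lemma card_light3 : ((q - 1) ^ 3 <= 2 * #|light3| + #|balanced3|)%N.
Proof.
pose P : {set Z} := [set~ 0].
have cP : #|P| = (q - 1)%N by rewrite cardsC1 card_ord Zp_cast //; lia.
have sub : setX (setX P P) P \subset
    light3 :|: (fun u : Z3 => (- u.1.1, - u.1.2, - u.2)) @: light3 :|: balanced3.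
  apply/subsetP=> -[[a b] c]; rewrite !inE /= => /andP[/andP[a0 b0] c0].
  have a0' : (0 < a)%N by rewrite lt0n.
  have b0' : (0 < b)%N by rewrite lt0n.
  have c0' : (0 < c)%N by rewrite lt0n.
  have aq := Zp_ltn a q1; have bq := Zp_ltn b q1; have cq := Zp_ltn c q1.
  rewrite a0' b0' c0' /=; case: (ltngtP (2 * (a + b + c)) (3 * q)) => //= abc.
    apply/orP; left; apply/imsetP; exists (- a, - b, - c); last by rewrite !opprK.
    by rewrite in_light3 !Zp_valN //; lia.
  by rewrite orbT.
by have := card_cover_neg sub; rewrite !cardsX cP -mulnA mulnC !expnS expn0 muln1 -mulnA.
Qed.

Lemma card_balanced3_odd : odd q -> #|balanced3| = 0%N.
Proof.
move=> qo; apply/eqP; rewrite cards_eq0; apply/eqP/setP=> u.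
by rewrite !inE; apply/negP=> /and4P[_ _ _]; lia.
Qed.

(* For a fixed first term [a], the second one ranges over the interval that
   keeps the third one in [1, q - 1]; the bounds for [a] and [r + a] add up to a
   constant. *)
Lemma card_balanced3_even r : q = (2 * r)%N -> (#|balanced3| + 3 * r <= 3 * r ^ 2 + 1)%N.
Proof.
move=> qr.
(* The third term is 3r - a - b. Being positive and below 2r, it confines b to a half-open interval
   together with 0 < b < 2r. *)
pose G a := if a is 0 then 0%N else (minn (2 * r) (3 * r - a) - maxn 1 (r.+1 - a))%N.
have le_block (a : Z) : (#|[set u in balanced3 | u.1.1 == a]| <= G a)%N.
  have [a0|a0] := posnP a.
    rewrite a0 leqn0 cards_eq0; apply/eqP/setP=> u; rewrite !inE.
    by apply/negP=> /andP[/and4P[u0 _ _ _] /eqP ua]; rewrite ua a0 in u0.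
  rewrite -(@card_in_imset _ _ (fun u : Z3 => u.1.2)); last first.
    move=> [[a1 b1] c1] [[a2 b2] c2]; rewrite !inE /=.
    move=> /andP[/and4P[_ _ _ /eqP E1] /eqP a1E] /andP[/and4P[_ _ _ /eqP E2] /eqP a2E] bE.
    rewrite a1E a2E bE in E1 E2 *; congr pair; apply: val_inj => /=; lia.
  rewrite (_ : G a = minn (2 * r) (3 * r - a) - maxn 1 (r.+1 - a))%N; last first.
    by move: a0; rewrite /G; case: (nat_of_ord a).
  apply: leq_trans (card_ord_interval (Zp_trunc q).+2 _ _); apply: subset_leq_card.
  apply/subsetP=> _ /imsetP[[[a1 b] c] + ->]; rewrite !inE /=.
  move=> /andP[/and4P[_ b0 c0 /eqP E] /eqP aE]; rewrite aE in E.
  have bq := Zp_ltn b q1; have cq := Zp_ltn c q1; lia.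
have -> : #|balanced3| = (\sum_(a : Z) #|[set u in balanced3 | u.1.1 == a]|)%N.
  rewrite -sum1_card (partition_big (fun u : Z3 => u.1.1) xpredT) //=.
  apply: eq_bigr => a _; rewrite -sum1_card; apply: eq_bigl => u.
  by rewrite !inE.
have le_sum : (\sum_(a : Z) #|[set u in balanced3 | u.1.1 == a]| <= \sum_(a < q) G a)%N.
  apply: (@leq_trans (\sum_(a : Z) G a)%N).
    by apply: leq_sum => a _; apply: le_block.
  by rewrite -(big_mkord xpredT G) -[X in (_ <= X)%N](big_mkord xpredT G) Zp_cast.
apply: leq_trans (leq_add le_sum (leqnn _)) _.
rewrite -(big_mkord xpredT G) qr mul2n -addnn (big_cat_nat (n := r)) ?leq_addr //=.
rewrite -{2}[r]add0n big_addn addnK -big_split /=.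
have [r' rE] : exists r', r = r'.+1 by exists r.-1; lia.
(* The pair 0, r contributes 2r - 1; each other pair a, r + a contributes (r - 1 + a) + (2r - 1 -
   a). *)
rewrite big_ltn ?rE // -rE (eq_big_nat _ _ (F2 := fun=> (3 * r - 2)%N)); last first.
  by move=> [|a] //= ar; rewrite /G addSn; lia.
rewrite sum_nat_const_nat rE /G /= !expnS expn0; nia.
Qed.

Definition zero_edges : {set Z3} := [set (0, 1, 1); (1, 0, 1); (1, 1, 0)].

Definition triple_term (u : Z3) (k : nat) : Z :=
  match k with 0 => u.1.1 | 1 => u.1.2 | _ => u.2 end.

Let val1 := Zp_val1 q.
Let valN1 : (- 1 : Z) = (q - 1)%N :> nat. Proof. by rewrite Zp_valN // val1. Qed.

Let N11 : (1 : Z) = - 1 -> False.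
Proof. by move/(congr1 (@nat_of_ord _)); rewrite valN1 val1; lia. Qed.
Let N10 : (1 : Z) = 0 -> False.
Proof. by move/(congr1 (@nat_of_ord _)); rewrite val1. Qed.
Let N0 (a : Z) : (0 < a)%N -> a = 0 -> False.
Proof. by move=> + a0; rewrite a0. Qed.

(** Sums of a light triple and of its negation add up to 3q, so they are not both below half of
    that. A zero can only face a zero, and light triples have none; two triples of [zero_edges]
    would force 1 = -1, 1 = 0 or 0 = -1. *)
Lemma base3_orientable : {in light3 :|: zero_edges &, forall u v,
  ~ (forall k, (k < 3)%N -> triple_term u k = -1 * triple_term v (2 - k)%N)}.
Proof.
move=> [[a b] c] [[a' b'] c'] uE vE H.
have [aE bE cE] : [/\ a = - c', b = - b' & c = - a'].
  have := (H 0%N isT, H 1%N isT, H 2%N isT).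
  by rewrite /= !mulN1r => -[[-> ->] ->].
have zP (x y z : Z) : (x, y, z) \in zero_edges ->
    [\/ [/\ x = 0, y = 1 & z = 1], [/\ x = 1, y = 0 & z = 1] |
        [/\ x = 1, y = 1 & z = 0]].
  by rewrite !inE => /orP[/orP[]|] /eqP[-> -> ->]; [constructor 1|constructor 2|constructor 3].
have N01 : 0 = - 1 :> Z -> False by move=> /esym/eqP; rewrite oppr_eq0 => /eqP.
case/setUP: uE => [|/zP] uE; case/setUP: vE => [|/zP] vE.
- rewrite !in_light3 in uE vE.
  have {uE} /and4P[a0 b0 c0 abc] := uE; have {vE} /and4P[a0' b0' c0' abc'] := vE.
  by move: abc; rewrite aE bE cE !Zp_valN //; lia.
- move: uE; rewrite in_light3 aE bE cE.
  by case: vE => [[-> _ _]|[_ -> _]|[_ _ ->]]; rewrite oppr0 /= ?andbF.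
- move: vE; rewrite in_light3 -[a']opprK -[b']opprK -[c']opprK -aE -bE -cE.
  by case: uE => [[-> _ _]|[_ -> _]|[_ _ ->]]; rewrite oppr0 /= ?andbF.
by case: uE aE bE cE => -[-> -> ->]; case: vE => -[-> -> ->]; rewrite ?oppr0.
Qed.

Lemma base3 : exists S m, seed 1 m (-1 : Z) S /\
  ((q - 1) ^ 3 <= 2 * (m + (q == 6).+1) + #|balanced3|)%N.
Proof.
pose F := light3 :|: zero_edges.
have [L [Lq Lc LU]] := loops_to_unit (\sum_(u in F) u.1.1) q2.
pose g (a : Z) : Z3 := (a, a, a).
have gK : cancel g (fun u => u.1.1) by [].
have gF a : a \in L -> g a \in F.
  by move=> /Lq/andP[a0 aq]; rewrite in_setU in_light3 a0; apply/orP; left; lia.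
pose E := F :\: g @: L.
have EF : {subset E <= F} by apply/subsetP/subsetDl.
have EI (a b c : Z) : (a, b, c) \in F -> a != b \/ b != c -> (a, b, c) \in E.
  move=> abc ne; rewrite in_setD abc andbT.
  by apply/imsetP=> -[d _ [aE bE cE]]; case: ne; rewrite ?aE ?bE ?cE eqxx.
have EL (a b c : Z) : (0 < a)%N -> (0 < b)%N -> (0 < c)%N ->
    (2 * (a + b + c) < 3 * q)%N -> a != b \/ b != c -> (a, b, c) \in E.
  by move=> a0 b0 c0 abc; apply: EI; rewrite in_setU in_light3 a0 b0 c0 abc.
have val2 : (2%:R : Z) = 2%N :> nat by rewrite val_Zp_nat // modn_small.
have N12 : 1 != 2%:R :> Z.
  by apply/eqP=> /(congr1 (@nat_of_ord _)); rewrite val2 val1.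
have N10' : 1 != 0 :> Z by apply/eqP.
have tE : (1, 1, 2%:R) \in E.
  by apply: EL; rewrite ?val2 ?val1 //; [lia|right].
have z1E : (0, 1, 1) \in E.
  by apply: EI; [rewrite !inE eqxx !orbT|left; rewrite eq_sym].
have z2E : (1, 0, 1) \in E by apply: EI; [rewrite !inE eqxx !orbT|left].
have z3E : (1, 1, 0) \in E by apply: EI; [rewrite !inE eqxx !orbT|right].
pose rot (u : Z3) : Z3 := (u.1.2, u.2, u.1.1).
have rotK : cancel rot (fun u => (u.2, u.1.1, u.1.2)) by case=> -[].
(* Both kinds of triples are closed under rotation, which gives the initial successor. *)
have [] := @circuit_seed q 1 (-1) Z3 (Z * Z)%type (fun u => u.1)
  (fun u => (u.1.2, u.2)) triple_term E (perm (can_inj rotK)).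
- by move=> [[a b] c] [[a' b'] c'] /= [-> ->] [|[|k]].
- move=> [[a b] c] [[a' b'] c'] _ _ H.
  by rewrite (H 0%N isT : a = a') (H 1%N isT : b = b') (H 2%N isT : c = c').
- by move=> u v /EF uE /EF vE; apply: base3_orientable.
- move=> [[a b] c] /EF/setUP[|].
    by rewrite in_light3 => /and4P[a0 _ _ _]; exists 0%N => //=; apply: N0.
  rewrite !inE => /orP[/orP[]|] /eqP[-> -> _]; [by exists 1%N|by exists 0%N..].
- by exists (0, 1, 1) => // -[].
- by rewrite /= (sum_remove_loops gK gF).
- apply/eulerian_permP => -[[a b] c] uE; rewrite permE /rot /=; split=> //=.
  move: uE; rewrite !in_setD => /andP[ng uF]; apply/andP; split.
    apply: contra ng => /imsetP[d dL [-> -> ->]]; exact: imset_f.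
  case/setUP: uF => [|]; rewrite in_setU.
    rewrite !in_light3 => /and4P[a0 b0 c0 abc]; rewrite a0 b0 c0.
    by apply/orP; left => /=; lia.
  by rewrite !inE => /orP[/orP[]|] /eqP[-> -> ->]; rewrite eqxx ?orbT.
- move=> A HA.
  (* Light triples follow (a, b, c), (b, c, 1), (c, 1, 1), (1, 1, 2), with shortcuts where a loop
     would occur; the others follow (1, 1, 0), (1, 0, 1), (0, 1, 1), (1, 1, 2). *)
  suff HT u : u \in E -> (u \in A) = ((1, 1, 2%:R) \in A).
    by move=> x y xE yE; rewrite !HT.
  have H1 a : (a, 1, 1) \in E -> ((a, 1, 1) \in A) = ((1, 1, 2%:R) \in A).
    by move=> aE; apply: HA.
  case: u => -[a b] c uE; case/setUP: (EF _ uE) => [|]; last first.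
    rewrite !inE => /orP[/orP[]|] /eqP[-> -> ->]; first exact: H1.
      by rewrite (HA _ (0, 1, 1)) ?H1.
    by rewrite (HA _ (1, 0, 1)) // (HA _ (0, 1, 1)) ?H1.
  rewrite in_light3 => /and4P[a0 b0 c0 abc].
  have step (x y z : Z) : (x, y, z) \in E -> (0 < x)%N -> (0 < y)%N -> (0 < z)%N ->
      (2 * (x + y + z) < 3 * q)%N -> y != z \/ z != 1 ->
      (y, z, 1) \in E /\ ((x, y, z) \in A) = ((y, z, 1) \in A).
    move=> xE x0 y0 z0 xyz ne; have yE : (y, z, 1) \in E.
      by apply: EL; rewrite ?val1 //; lia.
    by split=> //; apply: HA.
  have [c1|c1] := eqVneq c 1.
    have [b1|b1] := eqVneq b 1; first by rewrite c1 b1 in uE *; apply: H1.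
    have [|bE ->] := step _ _ _ uE a0 b0 c0 abc; first by left; rewrite c1.
    by rewrite c1 in bE *; apply: H1.
  have [|bE ->] := step _ _ _ uE a0 b0 c0 abc; first by right.
  have [|||cE ->] := step _ _ _ bE b0 c0; rewrite ?val1 //; [lia|by left|].
  exact: H1.
move=> S sS; exists S, #|E|; split=> //.
have := card_light3; rewrite (card_remove_loops gK gF).
(* The triples containing 0 are given away in the bound. *)
have : (#|light3| <= #|F|)%N by apply/subset_leq_card/subsetUl.
by move: #|light3| #|F| #|balanced3| #|L| Lc => x y z t; lia.
Qed.

End Base3.

(** * Periods after iteration and the stated bounds *)

Lemma iter_periodE (q m k : nat) : (1 < q)%N ->
  (iter k (fun x => (q * x).+1) m)%:R =
  q%:R ^+ k * m%:R + (q%:R ^+ k - 1) / (q%:R - 1) :> rat.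
Proof.
move=> q1; have q1' : q%:R - 1 != 0 :> rat by rewrite subr_eq0 pnatr_eq1; lia.
elim: k => [|k IH] /=; first by rewrite !expr0; field.
by rewrite -natr1 natrM IH exprS; field.
Qed.

Lemma seed_lift_good (q N m s : nat) (b : rat) (S : nat -> 'Z_q) :
  (2 < q)%N -> seed N m (-1) S -> b <= m%:R ->
  exists (S' : nat -> 'Z_q) (m' : nat),
    good_orientable (2 * s + N + 3) m' S' /\
    q%:R ^+ (2 * s + 1) * b + (q%:R ^+ (2 * s + 1) - 1) / (q%:R - 1) <= m'%:R.
Proof.
move=> q2 sS bm; have q1 : (1 < q)%N by lia.
have [|S' sS'] := seed_iter (2 * s + 1) q2 _ sS; first by rewrite mulrNN mulr1.
exists S', (iter (2 * s + 1) (fun x => (q * x).+1) m); split; last first.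
  by rewrite iter_periodE // lerD2r ler_wpM2l // exprn_ge0.
rewrite (_ : (2 * s + N + 3)%N = (2 * s + 1 + N).+2); last by lia.
apply: seed_good_orientable; move: sS'.
by rewrite exprD exprM sqrrN !expr1n mul1r expr1 mulrNN mulr1.
Qed.

Lemma m2_le (q m : nat) : (2 < q)%N ->
  ((q - 1) * (q - 2) <= 2 * (m + (q == 6).+1))%N -> m2 q <= m%:R.
Proof.
move=> q2; rewrite -(ler_nat rat) !natrM !natrB ?natrD; [|lia..].
by rewrite /m2; case: (q == 6) => /= H; lra.
Qed.

Lemma m3_le (q m : nat) (hq : (2 < q)%N) :
  ((q - 1) ^ 3 <= 2 * (m + (q == 6).+1) + #|balanced3 q|)%N -> m3 q <= m%:R.
Proof.
move=> cq; rewrite /m3; have [qo|qe] := boolP (odd q).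
  rewrite (card_balanced3_odd hq qo) in cq.
  have q6 : (q == 6) = false by apply/eqP=> q6; rewrite q6 in qo.
  move: cq; rewrite q6 -(ler_nat rat) natrX natrB ?natrD ?natrM ?natrD; [|lia].
  by move=> /=; lra.
have qr : q = (2 * q./2)%N by lia.
have := card_balanced3_even hq qr; move: #|balanced3 q| cq => c cq cr.
(* This is the term (3q^2 - 6q + 4)/4 of [m3], rewritten from r to q = 2r. *)
have {cr} : (4 * c + 6 * q <= 3 * q ^ 2 + 4)%N.
  by rewrite qr !expnS expn0 in cr *; nia.
rewrite -(ler_nat rat) natrD !natrM natrD natrM natrX.
move: cq; rewrite -(ler_nat rat) natrX natrB 1?natrD ?natrM ?natrD; last by lia.
by case: (q == 6) => /=; lra.
Qed.

Theorem theorem6 (q : nat) (hq : (2 < q)%N) (s : nat) :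
  (exists (S : nat -> 'Z_q) (m : nat),
     good_orientable (2 * s + 3) m S /\
     (q%:R ^+ (2 * s + 1) * m2 q
        + (q%:R ^+ (2 * s + 1) - 1) / (q%:R - 1) <= m%:R :> rat)) /\
  (exists (S : nat -> 'Z_q) (m : nat),
     good_orientable (2 * s + 4) m S /\
     (q%:R ^+ (2 * s + 1) * m3 q
        + (q%:R ^+ (2 * s + 1) - 1) / (q%:R - 1) <= m%:R :> rat)).
Proof.
split.
  have [S [m [sS mq]]] : exists (S : nat -> 'Z_q) m, seed 0 m (-1) S /\
      ((q - 1) * (q - 2) <= 2 * (m + (q == 6).+1))%N.
    have [q3|q3] := ltnP 3 q; first exact: base2.
    have -> : q = 3 by lia.
    by have [S sS] := base2_three; exists S, 1%N.
  by have := seed_lift_good s hq sS (m2_le hq mq); rewrite addn0.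
have [S [m [sS mq]]] := base3 hq.
by have := seed_lift_good s hq sS (m3_le hq mq); rewrite addn1 addSnnS.
Qed.
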